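(* Let $G=(V,E)$ be a finite simple connected graph. Let $F,F_0:\mathbb F_2^{V}\to \mathbb F_2^{V}$ be given by $F(s)=sP_s+P_s+s+1=(1+s)(1+P_s)$ and $F_0(s)=sP_s$, where $P_s(v)=\prod_{x\in N(v)}(1+s(x))$ for $v\in V$, and let $\mathcal X_1=\{F^2,F_0\}$, where $F^2=F\circ F$. For $s\in\mathbb F_2^{V}$ with $s\neq c_0$, the set $s^{-1}(1)$ is a maximal independent set of $G$ if and only if $s\in\ell_{\mathcal X_1}(\mathbb F_2^{V})$.
   Context: Graphs are undirected. $\mathbb F_2=\{0,1\}$ is the field with two elements and $\mathbb F_2^{V}$ is the set of functions (''configurations'') $V\to\mathbb F_2$, with pointwise addition and multiplication; $1$ denotes the constant function $1$ and $c_0$ the constant function $0$. $N(v)=\{x\in V : vx\in E\}$ is the open neighborhood of $v$. A subset $A\subseteq V$ is independent if no two vertices in $A$ are adjacent; a maximal independent set is an independent set not properly contained in a larger independent set (equivalently, an independent set that is also dominating, i.e. every vertex outside it is adjacent to a vertex in it). The free monoid $\mathcal F(a,b)$ on two generators $a,b$ acts on $\mathbb F_2^V$ by $a\cdot s=F^2(s)$, $b\cdot s=F_0(s)$, extended to words by composition (the empty word acts as the identity). $\mathrm{Orb}(s)=\{w\cdot s: w\in\mathcal F(a,b)\}$, and $\ell_{\mathcal X_1}(\mathbb F_2^V)$ is the set of all $s\in\mathbb F_2^V$ such that both $F^2$ and $F_0$ restrict to permutations of $\mathrm{Orb}(s)$.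
   Formalization: The one-vertex graph is excluded: there s = 1 has s^{-1}(1) maximal independent, but F² sends both 1 and c_0 to c_0, so F² does not permute Orb(s) = {1, c_0} and the stated equivalence fails. *)

(* Defs.v *)
From mathcomp Require Import all_boot all_order all_algebra.
From mathcomp Require Import classical_sets functions.

Set Implicit Arguments.
Unset Strict Implicit.
Unset Printing Implicit Defensive.

Import GRing.Theory.
Local Open Scope ring_scope.

(* Words over the generators a, b are sequences: the free monoid is [seq letter]. *)
Inductive letter := La | Lb.

Section Action.
Variables (T : Type) (X : letter -> T -> T).

(* Left action: the last letter of a word is applied first. *)
Definition act (w : seq letter) (t : T) : T := foldr X t w.

Definition Orb (t : T) : set T := range (fun w => act w t).

Definition ell : set T :=
  [set t | forall g : letter, set_bij (Orb t) (Orb t) (X g)]%classic.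

End Action.

Section Graph.
Variables (V : finType) (adj : rel V).

Definition nbhd (v : V) : {set V} := [set x | adj v x].

Definition independent (A : {set V}) : bool :=
  [forall x in A, forall y in A, ~~ adj x y].

Definition maximal_independent (A : {set V}) : bool := maxset independent A.

End Graph.

(* {ffun V -> 'F_2} carries the pointwise ring structure: 1 is the
   constant function 1 and 0 is c_0. *)

Section Dynamics.
Variables (V : finType) (adj : rel V).
Implicit Type s : {ffun V -> 'F_2}.

Definition P s : {ffun V -> 'F_2} := [ffun v => \prod_(x in nbhd adj v) (1 + s x)].

Definition F s : {ffun V -> 'F_2} := s * P s + P s + s + 1.

Definition F0 s : {ffun V -> 'F_2} := s * P s.

Definition X1 (g : letter) : {ffun V -> 'F_2} -> {ffun V -> 'F_2} :=
  match g with La => F \o F | Lb => F0 end.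

Definition ones s : {set V} := [set v | s v == 1].

End Dynamics.

(* Main.v *)
Require Import Defs.
From mathcomp Require Import all_boot all_order all_algebra.
From mathcomp Require Import classical_sets functions.

(** Identify [s] with the vertex set [S] on which it is 1, and let N(S) be the
    set of vertices with a neighbor in S.  Then F(S) = N(S) \ S and
    F_0(S) = S \ N(S).  If S is a maximal independent set then F(S) is the
    complement of S, so F^2 and F_0 both fix S and the orbit is {S}.  Conversely,
    if F_0 permutes the orbit, every member T of the orbit is independent, and
    then F^2(T) consists of T and of the vertices at distance 2 from T.  Hence
    F^2 is inflationary on the orbit, and being onto this finite set it is the
    identity there.  So no vertex is at distance 2 from S, and connectedness
    makes S dominating. *)

Import GRing.Theory.
Local Open Scope ring_scope.

Section Configurations.
Local Set Implicit Arguments.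
Local Unset Strict Implicit.
Variables (V : finType) (adj : rel V).
Implicit Types (s t : {ffun V -> 'F_2}) (A : {set V}).

Definition touched A (v : V) : bool := [exists x in A, adj v x].

Lemma F2_indicator (x : 'F_2) : x = (x == 1)%:R.
Proof. by case: x => [[|[|//]] lt_x]; apply: val_inj. Qed.

Lemma ones_indicator s v : s v = (v \in ones s)%:R.
Proof. by rewrite inE; apply: F2_indicator. Qed.

Lemma ones_inj : injective (@ones V).
Proof.
by move=> s t eq_st; apply/ffunP => v; rewrite (ones_indicator s) (ones_indicator t) eq_st.
Qed.

Lemma P_indicator s v : P adj s v = (~~ touched (ones s) v)%:R.
Proof.
rewrite ffunE; case: (boolP (touched _ _)) => [/existsP[x /andP[sx vx]] | /existsPn no_nb].
  (* A neighbor on which [s] is 1 contributes the factor 1 + 1 = 0. *)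
  rewrite (bigD1 x) ?inE //= ones_indicator sx.
  by rewrite (_ : 1 + true%:R = 0 :> 'F_2) ?mul0r //; apply: val_inj.
apply: big1 => x; rewrite inE => vx; rewrite ones_indicator.
by move: (no_nb x); rewrite vx andbT => /negPf ->; rewrite addr0.
Qed.

Lemma ones_F s v :
  (v \in ones (F adj s)) = (v \notin ones s) && touched (ones s) v.
Proof.
have -> : (v \in ones (F adj s)) = (s v * P adj s v + P adj s v + s v + 1 == 1).
  by rewrite inE !ffunE.
by rewrite P_indicator ones_indicator; case: (v \in _); case: touched.
Qed.

Lemma ones_F0 s v :
  (v \in ones (F0 adj s)) = (v \in ones s) && ~~ touched (ones s) v.
Proof.
have -> : (v \in ones (F0 adj s)) = (s v * P adj s v == 1) by rewrite inE !ffunE.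
by rewrite P_indicator ones_indicator; case: (v \in _); case: touched.
Qed.

Lemma independentP A :
  reflect {in A, forall v, ~~ touched A v} (independent adj A).
Proof.
apply: (iffP forall_inP) => indA v Av.
  by apply/existsP => -[x /andP[Ax vx]]; have/forall_inP/(_ x Ax)/negP := indA v Av.
apply/forall_inP => x Ax; apply/negP => vx.
by have /existsPn/(_ x) := indA v Av; rewrite Ax vx.
Qed.

(** A vertex that survives [F0] had no neighbor in S, hence has none among the survivors. *)
Lemma independent_F0 s : independent adj (ones (F0 adj s)).
Proof.
apply/independentP => v; rewrite ones_F0 => /andP[_ /existsPn no_nb].
by apply/existsPn => x; apply: contra (no_nb x); rewrite ones_F0 -andbA => /and3P[-> _ ->].
Qed.

Lemma F0_independent s : independent adj (ones s) -> F0 adj s = s.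
Proof.
move=> /independentP ind_s; apply: ones_inj; apply/setP => v; rewrite ones_F0.
by case: (boolP (v \in ones s)) => //= /ind_s ->.
Qed.

Hypotheses (adj_sym : symmetric adj) (adj_irr : irreflexive adj).

Lemma maximal_independentP A :
  reflect (independent adj A /\ forall v, v \notin A -> touched A v)
          (maximal_independent adj A).
Proof.
apply: (iffP maxsetP) => -[indA maxA]; split=> //.
  move=> v Av; apply: contraR Av => no_nb.
  (* An untouched vertex outside A could be added to A, against maximality; irreflexivity excludes a
     loop at v. *)
  suff ind_vA : independent adj (v |: A).
    by rewrite -(maxA _ ind_vA (finset.subsetUr _ _)) setU11.
  apply/independentP => y; rewrite !inE => yvA.
  apply/existsPn => x; rewrite !inE; apply/negP => /andP[xvA yx].
  case/orP: yvA xvA yx => [/eqP-> | Ay] /orP[/eqP-> | Ax] yx.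
  - by rewrite adj_irr in yx.
  - by case/existsP: no_nb; exists x; rewrite Ax.
  - by case/existsP: no_nb; exists y; rewrite Ay adj_sym.
  - by have /independentP/(_ y Ay)/existsPn/(_ x) := indA; rewrite Ax yx.
move=> B /independentP indB sAB; apply/eqP; rewrite finset.eqEsubset sAB andbT.
(* A vertex of B outside A would have a neighbor in A, hence in B, which is independent. *)
apply/fintype.subsetP => v Bv; apply: contraR (indB v Bv) => /maxA/existsP[x /andP[Ax vx]].
by apply/existsP; exists x; rewrite (fintype.subsetP sAB).
Qed.

Hypothesis no_isolated : forall v, exists x, adj v x.

Lemma FF_maximal_independent s :
  maximal_independent adj (ones s) -> F adj (F adj s) = s.
Proof.
case/maximal_independentP=> /independentP ind_s max_s.
have Fs v : (v \in ones (F adj s)) = (v \notin ones s).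
  by rewrite ones_F; case: (boolP (v \in ones s)) => //= /max_s ->.
apply: ones_inj; apply/setP => v; rewrite ones_F Fs negbK.
(* Here F(S) is the complement of S, so v in S reappears in F^2(S) only through a neighbor, which
   independence places outside S. *)
case: (boolP (v \in ones s)) => //= sv; have [x vx] := no_isolated v.
apply/existsP; exists x; rewrite Fs vx andbT.
by apply: contra (ind_s v sv) => sx; apply/existsP; exists x; rewrite sx.
Qed.

Lemma ones_F_independent s v :
  independent adj (ones s) -> (v \in ones (F adj s)) = touched (ones s) v.
Proof.
move=> /independentP ind_s; rewrite ones_F.
by case: (boolP (v \in ones s)) => //= /ind_s/negPf ->.
Qed.

(** A vertex v of S is not in F(S), but any neighbor of v is, and this neighbor brings v back. *)
Lemma inflationary_FF s :
  independent adj (ones s) -> ones s \subset ones (F adj (F adj s)).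
Proof.
move=> ind_s; apply/fintype.subsetP => v sv; rewrite ones_F ones_F sv /=.
have [x vx] := no_isolated v; apply/existsP; exists x.
rewrite ones_F_independent // vx andbT.
by apply/existsP; exists v; rewrite sv adj_sym.
Qed.

Lemma maximal_independent_FF_fixed s :
    (forall x y : V, connect adj x y) -> s <> 0 ->
    independent adj (ones s) -> F adj (F adj s) = s ->
  maximal_independent adj (ones s).
Proof.
move=> adj_connected s_neq0 ind_s FFs.
have [u su]: exists u, u \in ones s.
  apply/finset.set0Pn/eqP => s0; apply: s_neq0; apply/ffunP => v.
  by rewrite ones_indicator s0 inE ffunE.
(* The closed neighborhood of S: once stable under adjacency, it is all of V by connectedness. *)
pose D := [set v | (v \in ones s) || touched (ones s) v].
have inD v : (v \in D) = (v \in ones s) || touched (ones s) v by rewrite inE.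
have closedD : closed adj (mem D).
  apply: intro_closed => [|x y xy]; first exact: sym_connect_sym.
  rewrite !inD => /orP[sx | tx].
    by apply/orP; right; apply/existsP; exists x; rewrite sx adj_sym.
  (* If y is untouched, it lies outside F(S) and is adjacent to x in F(S), so it is in F^2(S) =
     S. *)
  case: (boolP (touched (ones s) y)) => [_|ty]; first by rewrite orbT.
  rewrite orbF -FFs ones_F ones_F_independent // ty /=.
  by apply/existsP; exists x; rewrite ones_F_independent // tx adj_sym.
apply/maximal_independentP; split=> // v /negPf sv.
by have := closed_connect closedD (adj_connected u v); rewrite !inD su sv /= => <-.
Qed.

End Configurations.

(** Strong induction on the size of the support: a preimage u of t in O has its support inside that
    of t. If the supports agree, u = t by injectivity; otherwise u is fixed by induction, and again
    t = f u = u. *)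
Lemma set_surj_inflationary_fixed (T : Type) (V : finType) (O : set T)
    (f : T -> T) (supp : T -> {set V}) :
    injective supp -> set_surj O O f ->
    (forall t, O t -> supp t \subset supp (f t)) ->
  forall t, O t -> f t = t.
Proof.
move=> inj_supp f_surj f_infl t.
have [n] := ubnP #|supp t|; elim: n t => // n IHn t; rewrite ltnS => le_tn Ot.
have [u Ou fu] := f_surj t Ot.
suff eq_ut : u = t by rewrite -{1}eq_ut.
have := f_infl u Ou; rewrite fu finset.subEproper => /predU1P[/inj_supp // | lt_ut].
by rewrite -fu (IHn u) // (leq_trans (proper_card lt_ut)).
Qed.

Theorem corollary4p3 (V : finType) (adj : rel V)
    (adj_sym : symmetric adj) (adj_irr : irreflexive adj)
    (adj_connected : forall x y : V, connect adj x y)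
    (V_neq1 : #|V| != 1%N)
    (s : {ffun V -> 'F_2}) (s_neq0 : s <> 0) :
  maximal_independent adj (ones s) <-> ell (X1 adj) s.
Proof.
(* This is where [V_neq1] enters. On a single vertex [P] is the empty product 1 and [F] is
   constantly 0, so s = 1 has maximal independent support while F^2 collapses its orbit {1, 0}. *)
have no_isolated v : exists x, adj v x.
  have [w /negPf wv] : exists w, w != v.
    apply/existsP; apply: contraR V_neq1 => /existsPn all_v.
    by rewrite (eq_card1 (x := v)) // => w; rewrite !inE; apply/esym/negPn/all_v.
  have /connectP[[|x p] /= vp wE] := adj_connected v w.
    by rewrite wE eqxx in wv.
  by case/andP: vp => vx _; exists x.
split=> [max_s | ell_s].
  have fix_s g : X1 adj g s = s.
    case: g; first exact: FF_maximal_independent.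
    by apply: F0_independent; case/maximal_independentP: max_s.
  have act_s w : act (X1 adj) w s = s by elim: w => //= g w ->; apply: fix_s.
  have orb_s : Orb (X1 adj) s = [set s]%classic.
    apply/seteqP; split=> [_ [w _ <-] | _ ->]; first exact: act_s.
    by exists nil.
  move=> g; rewrite orb_s; split=> [_ -> | t u | _ ->]; first exact: fix_s.
    by rewrite !inE => -> ->.
  by exists s.
(* Surjectivity of [F0] on the orbit makes each member t an image under [F0]. *)
have ind_orb t : Orb (X1 adj) s t -> independent adj (ones t).
  by move=> Ot; have [_ _ /(_ t Ot)[u _ <-]] := ell_s Lb; apply: independent_F0.
have orb_s : Orb (X1 adj) s s by exists nil.
apply: maximal_independent_FF_fixed => //; first exact: ind_orb.
have [_ _ FF_surj] := ell_s La.
apply: (set_surj_inflationary_fixed _ _ _ _ _ (@ones_inj V) FF_surj) => // t Ot.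
exact/inflationary_FF/ind_orb.
Qed.
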